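(* The Borel $\sigma$-algebra $\mathrm{Bor}(K\times K)$ of the product space $K\times K$ strictly contains $\mathrm{Bor}(K)\otimes \mathrm{Bor}(K)$.
   Context: Setting: $E$ is an uncountable abelian group with a total order $\le$ satisfying $a\le b\iff a-b\le 0$ for all $a,b\in E$; the order topology $\tau_0$ (generated by the sets $\{x<a\}$ and $\{x>b\}$, $a,b\in E$) is the group topology, and for it $E$ is locally compact, separable and connected. $\mu=m$ is the Haar measure of $E$. For $t\in E$ let $f^t$ be the characteristic function of $\{u\in E:u>t\}$, and let $A$ be the (norm-closed, unital) $C^*$-subalgebra of the complex space $L^\infty(E,\mu)$ generated by $\{f^t:t\in E\}$. $K=K_\mu(E)$ is the set of characters of $A$ with the weak$^*$ topology $\sigma(A^*,A)$, a compact Hausdorff space. $\mathrm{Bor}(X)$ is the Borel $\sigma$-algebra of $X$, and $\otimes$ denotes the product $\sigma$-algebra. *)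

(* Defs.v *)
From HB Require Import structures.
From mathcomp Require Import all_boot all_order all_algebra.
From mathcomp Require Import generic_quotient ring_quotient complex.
From mathcomp Require Import all_classical all_reals all_analysis.
From mathcomp Require Import measurable_realfun ess_sup_inf.

Set Implicit Arguments.
Unset Strict Implicit.
Unset Printing Implicit Defensive.

Import Order.TTheory GRing.Theory Num.Theory.
Import numFieldNormedType.Exports.
Import ComplexField.Normc.

Local Open Scope classical_set_scope.
Local Open Scope ring_scope.
Local Open Scope complex_scope.
Local Open Scope quotient_scope.

Definition is_topology (T : Type) (O : set (set T)) :=
  [/\ O setT, setI_closed O &
      forall F : set (set T), F `<=` O -> O (\bigcup_(A in F) A)].

Definition order_rays (T : Type) (lt : T -> T -> Prop) : set (set T) :=
  range (fun a => [set x | lt x a]) `|` range (fun b => [set x | lt b x]).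

(* A group topology that is the order topology of a compatible total order.
   The order is a plain relation because no structure joining the library's
   orderTopologicalType with topologicalZmodType can be declared on top of the
   existing hierarchy. *)
HB.mixin Record isOrderTopZmodule E of TopologicalZmodule E := {
  ole : rel E;
  ole_refl : reflexive ole;
  ole_anti : antisymmetric ole;
  ole_trans : transitive ole;
  ole_total : total ole;
  ole_sub : forall a b : E, ole a b <-> ole (a - b) 0;
  ole_open : @open E =
    smallest (@is_topology E) (order_rays (fun x y => ole x y && (x != y)))
}.

#[short(type="orderTopZmodType")]
HB.structure Definition OrderTopZmodule :=
  { E of TopologicalZmodule E & isOrderTopZmodule E }.

Definition olt (E : orderTopZmodType) (x y : E) : bool := ole x y && (x != y).

Definition separable_space (T : topologicalType) :=
  exists2 D : set T, countable D & dense D.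

Definition Bor (T : topologicalType) : set (set T) := <<s @open T >>.
Arguments Bor : clear implicits.

Definition prod_sigma_algebra (X Y : Type)
    (SX : set (set X)) (SY : set (set Y)) : set (set (X * Y)) :=
  <<s [set A `*` B | A in SX & B in SY] >>.

(* E with its Borel sigma-algebra; the library wants a pointed carrier, hence
   the otherwise irrelevant base point 0. *)
Definition borelType (E : topologicalZmodType) : Type := E.

Section borelType_measurable.
Variable E : topologicalZmodType.

HB.instance Definition _ := Choice.on (borelType E).
HB.instance Definition _ := isPointed.Build (borelType E) (0 : E).

Lemma Bor0 : Bor E set0.
Proof. exact: sigma_algebra0. Qed.

Lemma BorC (A : set E) : Bor E A -> Bor E (~` A).
Proof. by move=> EA; rewrite -setTD; exact: sigma_algebraCD. Qed.

Lemma BorU (F : (set E)^nat) : (forall i, Bor E (F i)) -> Bor E (\bigcup_i F i).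
Proof. exact: sigma_algebra_bigcup. Qed.

HB.instance Definition _ := @isMeasurable.Build (sigma_display (@open E))
  (borelType E) (Bor E) Bor0 BorC BorU.

End borelType_measurable.

(* A nonzero translation-invariant Radon measure. *)
Definition is_haar (R : realType) (E : topologicalZmodType)
    (mu : {measure set (borelType E) -> \bar R}) :=
  [/\ mu setT != 0%E,
      (forall (a : E) (B : set E), Bor E B -> mu ((+%R a) @` B) = mu B),
      (forall C : set E, compact C -> (mu C < +oo)%E),
      (forall B : set E, Bor E B ->
         mu B = ereal_inf
           [set mu U | U in [set U : set E | open U /\ B `<=` U]]) &
      (forall U : set E, open U ->
         mu U = ereal_sup
           [set mu C | C in [set C : set E | compact C /\ C `<=` U]])].

Lemma normc_ge0 (R : rcfType) (z : R[i]) : 0 <= normc z.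
Proof. by case: z => a b; exact: sqrtr_ge0. Qed.

(* Measurable, essentially bounded complex functions, before passing to classes
   of almost everywhere equal functions. *)
Section bounded_functions.
Context (R : realType) d (T : measurableType d)
  (mu : {measure set T -> \bar R}).

Definition cLfun : {pred T -> R[i]} := mem [set f : T -> R[i] |
  [/\ measurable_fun setT (@complex.Re R \o f),
      measurable_fun setT (@complex.Im R \o f) &
      exists M : R, \forall x \ae mu, normc (f x) <= M]].

Lemma cLfunP (f : T -> R[i]) : reflect
  [/\ measurable_fun setT (@complex.Re R \o f),
      measurable_fun setT (@complex.Im R \o f) &
      exists M : R, \forall x \ae mu, normc (f x) <= M] (f \in cLfun).
Proof. exact: asboolP. Qed.

Lemma cLfun_cst (c : R[i]) : cst c \in cLfun.
Proof.
apply/cLfunP; split; try exact: measurable_cst.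
by exists (normc c); exact: nearW.
Qed.

Lemma cLfun_subring : GRing.subring_closed cLfun.
Proof.
split=> [|f g /cLfunP[fR fI [M fM]] /cLfunP[gR gI [N gN]]|
         f g /cLfunP[fR fI [M fM]] /cLfunP[gR gI [N gN]]].
- exact: cLfun_cst.
- apply/cLfunP; split.
  + rewrite [X in measurable_fun _ X](_ : _ =
      (@complex.Re R \o f) \- (@complex.Re R \o g)).
      exact: measurable_funB.
    by apply/funext => x /=; rewrite !fctE; move: (f x) (g x) => [a b] [a' b'].
  + rewrite [X in measurable_fun _ X](_ : _ =
      (@complex.Im R \o f) \- (@complex.Im R \o g)).
      exact: measurable_funB.
    by apply/funext => x /=; rewrite !fctE; move: (f x) (g x) => [a b] [a' b'].
  + exists (M + N); apply: filterS2 fM gN => x fM gN.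
    by rewrite (le_trans (le_normcD _ _))// lerD// normcN.
- apply/cLfunP; split.
  + rewrite [X in measurable_fun _ X](_ : _ =
      (@complex.Re R \o f) \* (@complex.Re R \o g) \-
      (@complex.Im R \o f) \* (@complex.Im R \o g)).
      by apply: measurable_funB; exact: measurable_funM.
    by apply/funext => x /=; rewrite !fctE; move: (f x) (g x) => [a b] [a' b'].
  + rewrite [X in measurable_fun _ X](_ : _ =
      (@complex.Re R \o f) \* (@complex.Im R \o g) \+
      (@complex.Im R \o f) \* (@complex.Re R \o g)).
      by apply: measurable_funD; exact: measurable_funM.
    by apply/funext => x /=; rewrite !fctE; move: (f x) (g x) => [a b] [a' b'].
  + exists (M * N); apply: filterS2 fM gN => x fM gN.
    by rewrite normcM ler_pM// normc_ge0.
Qed.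

HB.instance Definition _ :=
  GRing.isSubringClosed.Build (T -> R[i]) cLfun cLfun_subring.

Definition cLfunType : Type := {f : T -> R[i] | f \in cLfun}.
HB.instance Definition _ := SubChoice.on cLfunType.
HB.instance Definition _ :=
  GRing.SubChoice_isSubComPzRing.Build _ _ cLfunType cLfun_subring.

Lemma cLfunBE (f g : cLfunType) x : val (f - g) x = val f x - val g x.
Proof. by []. Qed.

Lemma cLfunME (f g : cLfunType) x : val (f * g) x = val f x * val g x.
Proof. by []. Qed.

Lemma cLfun_conj (f : T -> R[i]) : f \in cLfun -> (@conjc R \o f) \in cLfun.
Proof.
move=> /cLfunP[fR fI [M fM]]; apply/cLfunP; split.
- rewrite [X in measurable_fun _ X](_ : _ = @complex.Re R \o f)//.
  by apply/funext => x /=; case: (f x).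
- rewrite [X in measurable_fun _ X](_ : _ = \- (@complex.Im R \o f)).
    exact: measurable_funN.
  by apply/funext => x /=; case: (f x).
- exists M; apply: filterS fM => x /=; move: (f x) => [a b].
  by rewrite /normc /conjc sqrrN.
Qed.

Definition conj_cLfun (f : cLfunType) : cLfunType :=
  Sub (@conjc R \o val f) (cLfun_conj (valP f)).

Definition cst_cLfun (c : R[i]) : cLfunType := Sub (cst c) (cLfun_cst c).

Definition null_cLfun : {pred cLfunType} :=
  mem [set f : cLfunType | \forall x \ae mu, val f x = 0].

Lemma null_cLfunP (f : cLfunType) :
  reflect (\forall x \ae mu, val f x = 0) (f \in null_cLfun).
Proof. exact: asboolP. Qed.

Lemma null_cLfun_zmod : GRing.zmod_closed null_cLfun.
Proof.
split=> [|f g /null_cLfunP f0 /null_cLfunP g0]; apply/null_cLfunP.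
  exact: nearW.
by apply: filterS2 f0 g0 => x fx gx; rewrite cLfunBE fx gx subr0.
Qed.

HB.instance Definition _ :=
  GRing.isZmodClosed.Build cLfunType null_cLfun null_cLfun_zmod.

End bounded_functions.
Arguments null_cLfun {R d T} mu.
Arguments cst_cLfun {R d T} mu c.

Section Linf.
Context (R : realType) d (T : measurableType d)
  (mu : {measure set T -> \bar R}).

Local Notation cLfunType := (cLfunType mu).

(* The complex L^oo(mu). *)
Definition Linf : Type := Quotient.quot (null_cLfun mu).
HB.instance Definition _ := Choice.on Linf.
HB.instance Definition _ := GRing.Zmodule.on Linf.
HB.instance Definition _ := Quotient.on Linf.

Lemma Linf_eqP (f g : cLfunType) :
  \pi_Linf f = \pi_Linf g <-> \forall x \ae mu, val f x = val g x.
Proof.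
split=> [/eqP|fg].
  rewrite -Quotient.idealrBE => /null_cLfunP; apply: filterS => x.
  by rewrite cLfunBE => /subr0_eq.
apply/eqP; rewrite -Quotient.idealrBE; apply/null_cLfunP.
by apply: filterS fg => x fgx; rewrite cLfunBE fgx subrr.
Qed.

Lemma Linf_reprP (f : cLfunType) :
  \forall x \ae mu, val (repr (\pi_Linf f)) x = val f x.
Proof. by apply/Linf_eqP; rewrite reprK. Qed.

Definition Linf_mul (x y : Linf) : Linf := \pi_Linf (repr x * repr y).

Lemma Linf_pi_mul (f g : cLfunType) :
  \pi_Linf (f * g) = Linf_mul (\pi_Linf f) (\pi_Linf g).
Proof.
apply/Linf_eqP; apply: filterS2 (Linf_reprP f) (Linf_reprP g) => x fx gx.
by rewrite !cLfunME fx gx.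
Qed.

Lemma Linf_pi_add (f g : cLfunType) :
  \pi_Linf (f + g) = \pi_Linf f + \pi_Linf g.
Proof. exact: Quotient.pi_add. Qed.

Lemma Linf_mulA : associative Linf_mul.
Proof.
move=> x y z; rewrite -[x]reprK -[y]reprK -[z]reprK.
move: (repr x) (repr y) (repr z) => f g h.
rewrite -(Linf_pi_mul g h) -(Linf_pi_mul f g).
by rewrite -(Linf_pi_mul f) -(Linf_pi_mul _ h) mulrA.
Qed.

Lemma Linf_mulC : commutative Linf_mul.
Proof. by move=> x y; rewrite /Linf_mul mulrC. Qed.

Lemma Linf_mul1 : left_id (\pi_Linf 1) Linf_mul.
Proof. by move=> x; rewrite -[x]reprK -(Linf_pi_mul 1) mul1r. Qed.

Lemma Linf_mulD : left_distributive Linf_mul +%R.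
Proof.
move=> x y z; rewrite -[x]reprK -[y]reprK -[z]reprK.
move: (repr x) (repr y) (repr z) => f g h.
rewrite -(Linf_pi_add f g) -(Linf_pi_mul _ h) mulrDl Linf_pi_add.
by rewrite -(Linf_pi_mul f) -(Linf_pi_mul g).
Qed.

HB.instance Definition _ := GRing.Zmodule_isComPzRing.Build
  Linf Linf_mulA Linf_mulC Linf_mul1 Linf_mulD.

Definition Linf_scale (c : R[i]) (x : Linf) : Linf :=
  \pi_Linf (cst_cLfun mu c) * x.

Lemma cst_cLfunM c c' : cst_cLfun mu (c * c') = cst_cLfun mu c * cst_cLfun mu c'.
Proof. exact/val_inj. Qed.

Lemma cst_cLfunD c c' : cst_cLfun mu (c + c') = cst_cLfun mu c + cst_cLfun mu c'.
Proof. exact/val_inj. Qed.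

Lemma Linf_scaleA c c' x : Linf_scale c (Linf_scale c' x) = Linf_scale (c * c') x.
Proof. by rewrite /Linf_scale mulrA cst_cLfunM (Linf_pi_mul (cst_cLfun mu c)). Qed.

Lemma Linf_scale1 : left_id 1 Linf_scale.
Proof.
move=> x; rewrite /Linf_scale (_ : cst_cLfun mu 1 = 1) ?mul1r//.
exact/val_inj.
Qed.

Lemma Linf_scaleDr : right_distributive Linf_scale +%R.
Proof. by move=> c x y; rewrite /Linf_scale mulrDr. Qed.

Lemma Linf_scaleDl x : {morph Linf_scale^~ x : c c' / c + c'}.
Proof. by move=> c c'; rewrite /Linf_scale cst_cLfunD Linf_pi_add mulrDl. Qed.

HB.instance Definition _ := GRing.Zmodule_isLmodule.Build R[i] Linf
  Linf_scaleA Linf_scale1 Linf_scaleDr Linf_scaleDl.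

(* Linf_conj and Linf_norm do not depend on the chosen representative. *)
Definition Linf_conj (x : Linf) : Linf := \pi_Linf (conj_cLfun (repr x)).

Definition Linf_norm (x : Linf) : R :=
  fine 'N[mu]_+oo%E[EFin \o (@normc R \o val (repr x))].

(* Norm-closed unital *-subalgebras. *)
Definition Cstar_subalgebra (B : set Linf) :=
  [/\ [/\ B 1, (forall x y, B x -> B y -> B (x + y)) &
          (forall x y, B x -> B y -> B (x * y))],
      (forall c x, B x -> B (c *: x)),
      (forall x, B x -> B (Linf_conj x)) &
      (forall x, (forall e : R, 0 < e ->
                    exists2 y, B y & Linf_norm (x - y) < e) -> B x)].

Definition Cstar_generated (G : set Linf) : set Linf :=
  smallest Cstar_subalgebra G.

(* Cstar_generated G as a type, with the operations inherited from Linf. *)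
Section subalgebra.
Variable G : set Linf.

Definition gen_pred : {pred Linf} := mem (Cstar_generated G).

Lemma gen_predP x : reflect (Cstar_generated G x) (x \in gen_pred).
Proof. exact: asboolP. Qed.

Lemma gen_pred_subring : GRing.subring_closed gen_pred.
Proof.
split=> [|x y /gen_predP Gx /gen_predP Gy|x y /gen_predP Gx /gen_predP Gy];
  apply/gen_predP => B [BC GB]; have [[B1 BD BM] BZ _ _] := BC => //.
- apply: BD; first exact: Gx.
  by rewrite -scaleN1r; apply: BZ; exact: Gy.
- by apply: BM; [exact: Gx|exact: Gy].
Qed.

Lemma gen_pred_scaler : GRing.scaler_closed gen_pred.
Proof.
move=> c x /gen_predP Gx; apply/gen_predP => B [BC GB].
by have [_ BZ _ _] := BC; apply: BZ; exact: Gx.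
Qed.

HB.instance Definition _ :=
  GRing.isSubringClosed.Build Linf gen_pred gen_pred_subring.
HB.instance Definition _ :=
  GRing.isScaleClosed.Build R[i] Linf gen_pred gen_pred_scaler.

Definition Cstar_gen : Type := {x : Linf | x \in gen_pred}.
HB.instance Definition _ := SubChoice.on Cstar_gen.
HB.instance Definition _ :=
  GRing.SubChoice_isSubComPzRing.Build _ _ Cstar_gen gen_pred_subring.
HB.instance Definition _ := [SubZmodule_isSubLmodule of Cstar_gen by <:].

Definition is_character (chi : Cstar_gen -> R[i]) :=
  [/\ scalar chi, {morph chi : x y / x * y} & exists x, chi x != 0].

(* The weak-* topology on the characters is that of pointwise convergence. *)
Definition characters : set {ptws Cstar_gen -> R[i]^o} :=
  [set chi | is_character chi].

Definition character_space : topologicalType := set_type characters.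

End subalgebra.

End Linf.

Section step_functions.
Context (R : realType) (E : orderTopZmodType)
  (mu : {measure set (borelType E) -> \bar R}).

Definition step (t : E) : borelType E -> R[i] :=
  fun u => if olt t u then 1 else 0.

Lemma step_cLfun t : step t \in cLfun mu.
Proof.
have mt : measurable ([set u | olt t u] : set (borelType E)).
  apply: sub_sigma_algebra; rewrite ole_open; apply: sub_gen_smallest.
  by right; exists t.
apply/cLfunP; split.
- rewrite [X in measurable_fun _ X](_ : _ = \1_[set u | olt t u]).
    exact: measurable_indic.
  apply/funext => u; rewrite /= /step indicE.
  by case: ifPn => tu; [rewrite mem_set|rewrite memNset//; exact/negP].
- rewrite [X in measurable_fun _ X](_ : _ = cst 0); first exact: measurable_cst.
  by apply/funext => u; rewrite /= /step; case: ifP.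
- exists 1; apply: nearW => u; rewrite /step; case: ifP => _.
    by rewrite normc1.
  by rewrite normc0.
Qed.

Definition step_Linf (t : E) : Linf mu :=
  \pi_(Linf mu) (Sub (step t) (step_cLfun t) : cLfunType mu).

(* The spectrum of the C*-algebra generated by the step functions. *)
Definition Kspace : topologicalType := character_space (range step_Linf).

End step_functions.
Arguments Kspace {R E} mu.

(* Main.v *)
Require Import Defs.
From mathcomp Require Import all_boot all_order all_algebra.
From mathcomp Require Import generic_quotient complex.
From mathcomp Require Import all_classical all_reals all_analysis.
From mathcomp Require Import ess_sup_inf.
Import Order.TTheory GRing.Theory Num.Theory.
Import numFieldNormedType.Exports.
Import ComplexField.Normc.
Local Open Scope classical_set_scope.
Local Open Scope ring_scope.
Local Open Scope complex_scope.

Set Implicit Arguments.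
Unset Strict Implicit.
Unset Printing Implicit Defensive.

(** The space [K] contains a copy of the split interval over [E].  Every point
[t] of [E] carries two characters [t+] and [t-] of the algebra [A], the
essential limits at [t] from the right and from the left
([one_sided_char true t] and [one_sided_char false t]).  These limits exist on
[A] because the classes which have an essential limit along a given filter form
a norm-closed unital *-subalgebra ([ess_cvg_Cstar_subalgebra]), and that
subalgebra contains the step functions ([step_ess_cvg]).  They are unique
because nonempty open sets have positive Haar measure ([haar_open_neq0]).  The
class of the step function at [t] takes the value [1] at [t+] and [0] at [t-],
so [t+] and [t-] differ for every [t].

Borel sets of [K] nevertheless cannot tell [t+] from [t-] except for countably
many [t] ([countable_separated]).  When [s] tends to [t] from the right, both
[s+] and [s-] tend to [t+] ([one_sided_char_cvg]); so if an open set contains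
[t+] but not [t-], it contains both [s+] and [s-] for all [s] in an interval
with left end [t].  The points [t] of this kind are therefore isolated from the
right, and there are only countably many of them because [E] is separable
([countable_side_isolated]).  The left side is symmetric, and the sets that
separate only countably many of given pairs of points form a sigma-algebra
([countable_separated_sigma_algebra]).

Applied to measurable rectangles, this last fact shows that a set in
[Bor(K) x Bor(K)] separates [(t+, t+)] from [(t+, t-)] for countably many [t]
only ([countable_pair_separated]).  The complement of the diagonal of [K x K] is
open and separates these two points for every [t].  As [E] is uncountable, that
open set is not in the product sigma-algebra. *)

(** * Limits of complex functions along a filter *)

Section complex_limits.
Context {R : realType} {T : Type} (F : set_system T).

(** The radii of the balls of [R[i]] are complex numbers, while the norm of
    [Linf] is real. *)
Lemma cvg_normcP {FF : Filter F} (f : T -> R[i]) (c : R[i]) :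
  f @ F --> (c : R[i]^o) <->
  forall e : R, 0 < e -> \forall x \near F, normc (f x - c) < e.
Proof.
have cvgE := @cvgrPdist_lt _ R[i]^o T F FF f c; split=> [/cvgE fc e e0|fc].
  have := fc e%:C; rewrite ltcR => /(_ e0); apply: filterS => x.
  by rewrite -ltcR distrC.
apply/cvgE => /= -[e e']; rewrite ltcE/= => /andP[/eqP -> /fc].
by apply: filterS => x; rewrite -ltcR distrC.
Qed.

Lemma normc_Re (z : R[i]) : `|complex.Re z| <= normc z.
Proof.
case: z => a b /=; rewrite -[leLHS]sqrtr_sqr ler_wsqrtr//.
by rewrite lerDl sqr_ge0.
Qed.

Lemma normc_Im (z : R[i]) : `|complex.Im z| <= normc z.
Proof.
case: z => a b /=; rewrite -[leLHS]sqrtr_sqr ler_wsqrtr//.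
by rewrite lerDr sqr_ge0.
Qed.

Lemma normc_le_ReIm (z : R[i]) :
  normc z <= `|complex.Re z| + `|complex.Im z|.
Proof.
case: z => a b /=; rewrite -[leRHS]ger0_norm ?addr_ge0//.
rewrite -[leRHS]sqrtr_sqr ler_wsqrtr// sqrrD !real_normK ?num_real//.
by rewrite lerD2r lerDl mulrn_wge0// mulr_ge0.
Qed.

(** Completeness of the complex plane, obtained from that of the real line by
    splitting a function into its real and imaginary parts. *)
Lemma cauchy_normc_cvg {FF : ProperFilter F} (f : T -> R[i]) :
  (forall e : R, 0 < e ->
     exists c, \forall x \near F, normc (f x - c) < e) ->
  exists c, f @ F --> (c : R[i]^o).
Proof.
move=> f_cauchy.
have part_cvg (p : R[i] -> R) :
    (forall z w, p (z - w) = p z - p w) -> (forall z, `|p z| <= normc z) ->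
    exists a : R, (p \o f) @ F --> a.
  move=> pB ple; apply/cvg_ex; apply: cauchy_cvg; apply/cauchyP => e e0.
  have [c fc] := f_cauchy _ e0; exists (p c).
  rewrite /nbhs/=; apply: filterS fc => x fxc.
  by rewrite /ball/= distrC -pB (le_lt_trans (ple _)).
have [|a fa] := part_cvg (@complex.Re R) _ normc_Re; first by case=> ? ? [].
have [|b fb] := part_cvg (@complex.Im R) _ normc_Im; first by case=> ? ? [].
exists (a +i* b); apply/cvg_normcP => e e0.
have e20 : 0 < e / 2 by rewrite divr_gt0.
move/cvgrPdist_lt/(_ _ e20): fa => fa; move/cvgrPdist_lt/(_ _ e20): fb => fb.
apply: filterS2 fa fb => x fax fbx.
rewrite (le_lt_trans (normc_le_ReIm _))// [ltRHS]splitr.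
move: fax fbx; rewrite /= distrC [X in _ -> X < _ -> _]distrC.
by case: (f x) => u v /=; exact: ltrD.
Qed.

Lemma conjc_cvg {FF : Filter F} (f : T -> R[i]) (c : R[i]) :
  f @ F --> (c : R[i]^o) -> (@conjc R \o f) @ F --> (conjc c : R[i]^o).
Proof.
move=> /cvg_normcP fc; apply/cvg_normcP => e /fc {fc}; apply: filterS => x /=.
by case: (f x) c => [a b] [a' b'] /=; rewrite -opprD sqrrN.
Qed.

End complex_limits.

(** * Essential limits and the characters that they define *)

Section essential_limits.
Context (R : realType) d (T : measurableType d).
Context (mu : {measure set T -> \bar R}).
Context {F : set_system T} {FF : ProperFilter F}.
(* A filter finer than the almost everywhere filter does not see the choice of
   a representative, so limits along it make sense on [Linf mu]. *)
Hypothesis aeF : almost_everywhere mu `<=` F.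

Definition ess_cvg (x : Linf mu) (c : R[i]) :=
  val (repr x) @ F --> (c : R[i]^o).

Lemma ess_cvg_unique {x : Linf mu} {c c'} :
  ess_cvg x c -> ess_cvg x c' -> c = c'.
Proof. exact: (@cvg_unique _ (@norm_hausdorff _ (R[i]^o))). Qed.

Lemma ess_cvg_pi (f : cLfunType mu) (c : R[i]) :
  val f @ F --> (c : R[i]^o) -> ess_cvg (\pi_(Linf mu)%qT f) c.
Proof.
apply: cvg_trans; apply: near_eq_cvg; apply: aeF.
by apply: filterS (Linf_reprP f) => x ->.
Qed.

Lemma ess_cvgD (x y : Linf mu) (a b : R[i]) :
  ess_cvg x a -> ess_cvg y b -> ess_cvg (x + y) (a + b).
Proof.
move=> xa yb; rewrite -[x]reprK -[y]reprK -Linf_pi_add; apply: ess_cvg_pi.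
exact: (@cvgD _ R[i]^o _ F FF _ _ _ _ xa yb).
Qed.

Lemma ess_cvgM (x y : Linf mu) (a b : R[i]) :
  ess_cvg x a -> ess_cvg y b -> ess_cvg (x * y) (a * b).
Proof.
move=> xa yb; apply: (@ess_cvg_pi (repr x * repr y)).
exact: (@cvgM R[i] _ F FF _ _ _ _ xa yb).
Qed.

Lemma ess_cvg_cst (c : R[i]) : ess_cvg (\pi_(Linf mu)%qT (cst_cLfun mu c)) c.
Proof. by apply: ess_cvg_pi; exact: (@cvg_cst R[i]^o). Qed.

Lemma ess_cvgZ (k : R[i]) (x : Linf mu) (c : R[i]) :
  ess_cvg x c -> ess_cvg (k *: x) (k * c).
Proof. by apply: ess_cvgM; exact: ess_cvg_cst. Qed.

Lemma ess_cvg_conj (x : Linf mu) (c : R[i]) :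
  ess_cvg x c -> ess_cvg (Linf_conj x) (conjc c).
Proof. by move=> xc; apply: ess_cvg_pi; exact: conjc_cvg. Qed.

Lemma ess_cvg1 : ess_cvg 1 1.
Proof. by apply: ess_cvg_pi; exact: (@cvg_cst R[i]^o). Qed.

(** [Linf_norm] turns an extended real essential supremum into a real number and
    sends infinity to [0]; the essential boundedness of [x] excludes that
    case. *)
Lemma Linf_norm_lt (x : Linf mu) (e : R) :
  0 < e -> Linf_norm x < e -> \forall t \ae mu, normc (val (repr x) t) < e.
Proof.
move=> e0; rewrite /Linf_norm unlock; case: ifPn => [mu0|]; last first.
  rewrite -leNgt => muT0 _.
  exists setT; split => //; apply/eqP.
  by rewrite eq_le measure_ge0 muT0.
have [_ _ [M xM]] := cLfunP _ _ (valP (repr x)).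
set f := (X in ess_sup _ X).
have f_le (t : T) : (f t = (normc (val (repr x) t))%:E).
  by rewrite /f/= ger0_norm// normc_ge0.
have supM : (ess_sup mu f <= M%:E)%E.
  by apply/ess_supP; apply: filterS xM => t; rewrite f_le lee_fin.
have sup0 : (0 <= ess_sup mu f)%E.
  apply: ess_sup_gee => //; apply: nearW => t.
  by rewrite f_le lee_fin normc_ge0.
have fin : ess_sup mu f \is a fin_num.
  by rewrite ge0_fin_numE// (le_lt_trans supM)// ltry.
move=> lte; apply: filterS (ess_sup_ge mu f) => t; rewrite f_le => fle.
by rewrite -lte_fin (le_lt_trans fle)// -(fineK fin) lte_fin.
Qed.

(** Only closedness under norm limits is not formal: if [x] is within [e/2] of
    some [y] that tends to [c], then [x] is eventually within [e] of [c], hence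
    [x] is Cauchy along [F]. *)
Lemma ess_cvg_Cstar_subalgebra :
  Cstar_subalgebra [set x : Linf mu | exists c, ess_cvg x c].
Proof.
split=> [|k x [c xc]|x [c xc]|x x_lim].
- split=> [|x y [a xa] [b yb]|x y [a xa] [b yb]].
  + by exists 1; exact: ess_cvg1.
  + by exists (a + b); exact: ess_cvgD.
  + by exists (a * b); exact: ess_cvgM.
- by exists (k * c); exact: ess_cvgZ.
- by exists (conjc c); exact: ess_cvg_conj.
- apply: cauchy_normc_cvg => e e0; have e20 : 0 < e / 2 by rewrite divr_gt0.
  have [y [c /cvg_normcP yc] xy] := x_lim _ e20.
  exists c; have /aeF xyF := Linf_norm_lt e20 xy.
  have /aeF xyE := Linf_reprP (repr x - repr y).
  have xyr : \pi_(Linf mu)%qT (repr x - repr y) = x - y.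
    apply: (addIr y); rewrite subrK -{2}(reprK y) -Linf_pi_add subrK.
    exact: reprK.
  rewrite xyr in xyE.
  near=> t.
  rewrite (_ : _ - c = val (repr (x - y)) t + (val (repr y) t - c)); last first.
    by rewrite (near xyE t)// cLfunBE addrA subrK.
  rewrite (le_lt_trans (le_normcD _ _))// [ltRHS]splitr ltrD//.
    by near: t.
  by near: t; exact: yc.
Unshelve. all: by end_near. Qed.

Context {G : set (Linf mu)}.
Hypothesis G_cvg : forall x, G x -> exists c, ess_cvg x c.

Definition ess_lim (y : Cstar_gen G) : R[i] := xget 0 (ess_cvg (val y)).

Lemma ess_limP (y : Cstar_gen G) : ess_cvg (val y) (ess_lim y).
Proof.
have : [set x : Linf mu | exists c, ess_cvg x c] (val y).
  have /gen_predP := valP y; apply; split => //.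
  exact: ess_cvg_Cstar_subalgebra.
by move=> [c yc]; exact: (xgetPex 0 (ex_intro _ c yc)).
Qed.

Lemma ess_lim_is_character : is_character ess_lim.
Proof.
split=> [k x y|x y|].
- apply: ess_cvg_unique (@ess_limP _) _.
  by apply: ess_cvgD (@ess_limP y); apply: ess_cvgZ; exact: ess_limP.
- apply: ess_cvg_unique (@ess_limP _) _.
  by apply: ess_cvgM; exact: ess_limP.
- by exists 1; rewrite (ess_cvg_unique (@ess_limP 1) ess_cvg1) oner_eq0.
Qed.

End essential_limits.

(** * The weak-* topology on the characters *)

Lemma character_space_cvg (R : realType) d (T : measurableType d)
    (mu : {measure set T -> \bar R}) (G : set (Linf mu))
    (I : Type) (H : set_system I) {FH : Filter H}
    (g : I -> character_space G) (z : character_space G) :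
  (forall y, (fun i => val (g i) y) @ H --> (val z y : R[i]^o)) -> g @ H --> z.
Proof.
move=> gz.
have : (fun i => val (g i)) @ H --> (val z : {ptws Cstar_gen G -> R[i]^o}).
  apply/cvg_sup => y U [_ [[W oW <-] Wz]] /filterS; apply.
  by apply: gz; exact: open_nbhs_nbhs.
move=> gzv U [_ [[W oW <-] Wz]] /filterS; apply.
by apply: gzv; exact: open_nbhs_nbhs.
Qed.

Lemma character_eval_continuous (R : realType) d (T : measurableType d)
    (mu : {measure set T -> \bar R}) (G : set (Linf mu)) (y : Cstar_gen G) :
  continuous (fun p : character_space G => val p y : R[i]^o).
Proof.
have eval_cont : continuous
    (fun f : {ptws Cstar_gen G -> R[i]^o} => f y : R[i]^o).
  move=> f; have /cvg_sup/(_ y) : nbhs f --> f by [].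
  by move=> fy U Uf; apply: fy; exact: initial_continuous.
move=> p; apply: (@continuous_comp _ _ _ _ _ p _ (eval_cont _)).
exact: initial_continuous.
Qed.

(** Two distinct characters differ at some [y], and being different at [y] is an
    open condition. *)
Lemma open_off_diagonal (R : realType) d (T : measurableType d)
    (mu : {measure set T -> \bar R}) (G : set (Linf mu)) :
  open [set pq : character_space G * character_space G | pq.1 <> pq.2].
Proof.
have -> : [set pq : character_space G * character_space G | pq.1 <> pq.2] =
    \bigcup_y [set pq | val pq.1 y - val pq.2 y != 0].
  apply/seteqP; split=> [[p q]/= pNq|[p q] [y _ /= pqy] pq]; last first.
    by move: pqy; rewrite pq subrr eqxx.
  apply: contrapT => allE; apply: pNq; apply: val_inj; apply/funext => y.
  by apply: contrapT => /eqP pqy; apply: allE; exists y; rewrite //= subr_eq0.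
apply: bigcup_open => y _.
have y_cont := @character_eval_continuous _ _ _ _ G y.
apply: (@open_comp _ _ (fun pq : character_space G * character_space G =>
  val pq.1 y - val pq.2 y : R[i]^o) [set z | z != 0]) => [pq _|].
  apply: (@cvgB _ R[i]^o).
  - by apply: (@continuous_comp _ _ _ fst _ pq _ (y_cont _)); exact: cvg_fst.
  - by apply: (@continuous_comp _ _ _ snd _ pq _ (y_cont _)); exact: cvg_snd.
rewrite (_ : [set z | z != 0] = ~` [set 0]).
  apply: closed_openC; apply: accessible_closed_set1.
  exact: (hausdorff_accessible (@norm_hausdorff _ R[i]^o)).
by apply/seteqP; split=> z /= /eqP.
Qed.

(** * Borel sigma-algebras of products and separation of points *)

Lemma Bor_preimage (X Y : topologicalType) (f : X -> Y) (A : set Y) :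
  continuous f -> Bor Y A -> Bor X (f @^-1` A).
Proof.
move=> cf; move: A; apply: (@smallest_sub _ _ _ [set A | Bor X (f @^-1` A)]).
  split=> [|A XA|F XF] /=.
  - by rewrite preimage_set0; exact: sigma_algebra0.
  - exact: sigma_algebraCD XA.
  - by rewrite preimage_bigcup; exact: sigma_algebra_bigcup.
by move=> U openU; apply: sub_sigma_algebra; apply: open_comp openU => x _.
Qed.

Lemma prod_sigma_algebra_Bor (X Y : topologicalType) :
  prod_sigma_algebra (Bor X) (Bor Y) `<=` Bor (X * Y)%type.
Proof.
apply: smallest_sub; first exact: smallest_sigma_algebra.
move=> _ [A XA [B YB <-]].
have -> : A `*` B = fst @^-1` A `&` snd @^-1` B by [].
rewrite -[_ `&` _]setCK setCI.
rewrite -setTD; apply: sigma_algebraCD; rewrite -bigcup2E.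
apply: sigma_algebra_bigcup => -[|[|i]] /=; last exact: sigma_algebra0.
- rewrite -setTD; apply: sigma_algebraCD; apply: Bor_preimage XA => x.
  exact: cvg_fst.
- rewrite -setTD; apply: sigma_algebraCD; apply: Bor_preimage YB => x.
  exact: cvg_snd.
Qed.

(** The exceptional indices of a complement are those of the set, and those of
    a countable union lie in the union of the exceptional sets. *)
Lemma countable_separated_sigma_algebra (I X : Type) (p q : I -> X) :
  sigma_algebra setT [set A : set X | countable [set i | A (p i) <> A (q i)]].
Proof.
split=> [|A cA|F cF] /=.
- by apply: sub_countable (countable0 I); apply: subset_card_le => i [].
- apply: sub_countable cA; apply: subset_card_le => i; apply: contra_not => AE.
  by rewrite /= /setD/= AE.
- have := bigcup_countable (countableP [set: nat]) (fun n _ => cF n).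
  apply: sub_countable; apply: subset_card_le => i /= FN.
  apply: contrapT => NF; apply: FN.
  have FE n : F n (p i) = F n (q i).
    by apply: contrapT => FnE; apply: NF; exists n.
  by apply/propext; split=> -[n _ Fn]; exists n => //; [rewrite -FE|rewrite FE].
Qed.

(** * The order of [E] seen from either side *)

Section one_sided_order.
Context {E : orderTopZmodType}.
Implicit Types (b : bool) (r s t x : E).

(** The order of [E] for [b = true], the opposite order for [b = false]:
    statements about right limits then give those about left limits. *)
Definition side_lt b x y := if b then olt x y else olt y x.

Definition side_itv b t s : set E := [set x | side_lt b t x && side_lt b x s].

Lemma olt_trans : transitive (@olt E).
Proof.
move=> y x z /andP[xy xNy] /andP[yz _]; apply/andP; split.
  exact: ole_trans xy yz.
by apply: contra xNy => /eqP xz; apply/eqP/ole_anti; rewrite xy xz.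
Qed.

Lemma olt_nge x y : olt x y = ~~ ole y x.
Proof.
have [->|xy] := eqVneq x y; first by rewrite /olt eqxx andbF ole_refl.
rewrite /olt xy andbT; have := ole_total x y; have := @ole_anti E x y.
by case: (ole x y) (ole y x) => [] [] // /(_ isT) /eqP; rewrite (negbTE xy).
Qed.

Lemma side_lt_trans b : transitive (side_lt b).
Proof.
by case: b => y x z /= xy yz; [apply: olt_trans yz|apply: olt_trans xy].
Qed.

Lemma side_ltxx b x : side_lt b x x = false.
Proof. by rewrite /side_lt /olt eqxx andbF if_same. Qed.

Lemma side_lt_total b x y : x != y -> side_lt b x y || side_lt b y x.
Proof.
have : x != y -> olt x y || olt y x.
  by move=> xy; rewrite /olt (eq_sym y) xy !andbT ole_total.
by case: b => //=; rewrite orbC.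
Qed.

Lemma side_ltN b x y : side_lt (~~ b) x y = side_lt b y x.
Proof. by case: b. Qed.

Lemma open_ray b x : open [set y | side_lt b x y].
Proof.
rewrite ole_open; apply: sub_gen_smallest.
by case: b; [right|left]; exists x.
Qed.

Lemma open_side_itv b t s : open (side_itv b t s).
Proof.
rewrite (_ : side_itv b t s =
    [set x | side_lt b t x] `&` [set x | side_lt (~~ b) s x]).
  by apply: openI; exact: open_ray.
by apply/seteqP; split=> x /=; rewrite side_ltN => /andP.
Qed.

(** If no point lay strictly between [t] and [s], the open ray beyond [t] would
    be the complement of an open ray, hence clopen. *)
Lemma side_lt_dense b t s : connected [set: E] ->
  side_lt b t s -> side_itv b t s !=set0.
Proof.
move=> connE ts; apply/set0P/negP => /eqP empty.
have rayE : [set x | side_lt b t x] = ~` [set x | side_lt (~~ b) s x].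
  apply/seteqP; split=> x /=; rewrite side_ltN; [move=> tx xs|move=> /negP xs].
    by have : set0 x by rewrite -empty; apply/andP.
  have [<-//|xNs] := eqVneq s x.
  apply: side_lt_trans ts _.
  by move: (side_lt_total b xNs); rewrite (negbTE xs) orbF.
have : [set x | side_lt b t x] = setT.
  apply: connE.
  - by exists s.
  - by exists [set x | side_lt b t x]; [exact: open_ray|rewrite setTI].
  - exists [set x | side_lt b t x]; last by rewrite setTI.
    by rewrite rayE closedC; exact: open_ray.
by move=> /(congr1 (@^~ t))/=; rewrite side_ltxx propeqE => -[_ /(_ I)].
Qed.

Lemma olt_addr t a : olt 0 a -> olt t (t + a).
Proof.
move=> /andP[a_ge0 a0]; apply/andP; split.
  apply/ole_sub; rewrite opprD addNKr.
  by move/ole_sub: a_ge0; rewrite sub0r.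
by rewrite eq_sym -subr_eq0 addrC addKr eq_sym.
Qed.

(** An ordered group with more than one element has no largest and no smallest
    element: translate by a positive element. *)
Lemma side_lt_exists b t : ~ countable [set: E] -> exists s, side_lt b t s.
Proof.
move=> uncE.
have [a a0] : exists a : E, 0 != a.
  apply: contrapT => all0; apply: uncE.
  rewrite (_ : [set: E] = [set 0]); first exact: countable1.
  apply/seteqP; split=> // x _; apply/esym/eqP/negPn/negP => x0.
  by apply: all0; exists x.
have [c c_gt0] : exists c : E, olt 0 c.
  have /orP[|a_lt0] := side_lt_total true a0; first by exists a.
  exists (- a); move: a_lt0 => /= /andP[a_le0 aN0]; apply/andP; split.
    by apply/ole_sub; rewrite sub0r opprK.
  by rewrite eq_sym oppr_eq0.
case: b; first by exists (t + c); exact: olt_addr.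
by exists (t - c) => /=; have := olt_addr (t - c) c_gt0; rewrite subrK.
Qed.

Lemma side_itvS b t s s' : side_lt b s s' ->
  side_itv b t s `<=` side_itv b t s'.
Proof.
move=> ss' x /andP[tx xs]; apply/andP; split=> //.
exact: side_lt_trans xs ss'.
Qed.

Lemma side_itv_meet b t s s' : side_lt b t s -> side_lt b t s' ->
  exists2 s'', side_lt b t s'' &
    side_itv b t s'' `<=` side_itv b t s `&` side_itv b t s'.
Proof.
move=> ts ts'; have [ss'|sNs'] := eqVneq s s'.
  by exists s => //; rewrite -ss' setIid.
have /orP[ss'|s's] := side_lt_total b sNs'.
  by exists s => // x sx; split=> //; exact: (side_itvS ss').
by exists s' => // x sx; split=> //; exact: (side_itvS s's).
Qed.

End one_sided_order.

(** The gaps next to the points of [S] are pairwise disjoint nonempty open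
    intervals, so choosing in each of them a point of a countable dense set is
    injective. *)
Lemma countable_side_isolated (E : orderTopZmodType) (b : bool) (S : set E) :
  separable_space E -> connected [set: E] ->
  (forall t, S t -> exists2 s, side_lt b t s & side_itv b t s `<=` ~` S) ->
  countable S.
Proof.
move=> [D cD dD] connE isol.
have /choice[p pP] (t : E) : exists d : E, S t ->
    D d /\ exists s, side_itv b t s d /\ side_itv b t s `<=` ~` S.
  have [St|NSt] := pselect (S t); last by exists t.
  have [s ts gap] := isol t St.
  have [d [td Dd]] := dD _ (side_lt_dense connE ts) (open_side_itv _ _ _).
  by exists d => _; split=> //; exists s.
have p_mono t t' : S t -> S t' -> side_lt b t t' -> side_lt b (p t) (p t').
  move=> St St' tt'.
  have [_ [s [/andP[_ ps] gap]]] := pP t St.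
  have [_ [s' [/andP[t'p _] _]]] := pP t' St'.
  have [st'|sNt'] := eqVneq s t'.
    by rewrite st' in ps; exact: side_lt_trans ps t'p.
  have /orP[st'|t's] := side_lt_total b sNt'.
    exact: side_lt_trans ps (side_lt_trans st' t'p).
  by exfalso; apply: (gap t') => //; apply/andP.
have p_inj : {in S &, injective p}.
  move=> t t' /set_mem St /set_mem St' ptt'; apply: contrapT => /eqP tNt'.
  by have /orP[/p_mono|/p_mono] := side_lt_total b tNt';
    move=> /(_ ltac:(by []) ltac:(by [])); rewrite ptt' side_ltxx.
rewrite -(eq_countable (inj_card_eq p_inj)).
apply: sub_countable cD; apply: subset_card_le => _ [t St <-].
by have [] := pP t St.
Qed.

(** * Nonempty open sets are not null *)

(** The translates of [U] by the points of a countable dense set cover the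
    group, which would be null if [U] were. *)
Lemma haar_open_neq0 (R : realType) (E : topologicalZmodType)
    (mu : {measure set (borelType E) -> \bar R}) (U : set E) :
  separable_space E -> is_haar mu -> open U -> U !=set0 -> mu U != 0%E.
Proof.
move=> [D cD dD] [muT muD _ _ _] openU [u Uu].
apply: contra_neq muT => muU.
have trE (a : E) : (+%R a) @` U = (fun x => x - a) @^-1` U.
  apply/seteqP; split=> [_ [x Ux <-]|x Ux] /=; first by rewrite addrC addKr.
  by exists (x - a) => //; rewrite addrC subrK.
have subC : continuous (fun x : E * E => x.1 - x.2) by exact: sub_continuous.
have opentr (a : E) : open ((+%R a) @` U).
  rewrite trE; apply: open_comp openU => x _.
  apply: (@continuous_comp _ _ _ (fun x => (x, a)) _ x _ (subC _)).
  by apply: cvg_pair; [exact: cvg_id|exact: cvg_cst].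
have /pcard_surjP[g gD] : ((D : set (borelType E)) #<= [set: nat])%card.
  exact: cD.
have : mu.-negligible (\bigcup_n ((+%R (g n)) @` U)).
  apply: negligible_bigcup => n; exists ((+%R (g n)) @` U); split => //.
    exact: sub_sigma_algebra.
  by rewrite muD//; exact: sub_sigma_algebra.
rewrite (_ : \bigcup_n _ = setT).
  by move=> /negligibleP; apply; exact: measurableT.
apply/seteqP; split=> // x _.
have [||d [/= Ud Dd]] := dD ((fun d => x - d) @^-1` U).
(* The open set of all [d] such that [x] lies in the translate of [U] by [d] is
   not empty: it contains [x - u]. *)
- by exists (x - u) => /=; rewrite subKr.
- apply: open_comp openU => d _.
  apply: (@continuous_comp _ _ _ (fun d => (x, d)) _ d _ (subC _)).
  by apply: cvg_pair; [exact: cvg_cst|exact: cvg_id].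
have [n _ gnd] := gD d Dd.
by exists n => //; rewrite trE /= gnd.
Qed.

(** * The characters t+ and t- *)

Section one_sided_limits.
Context {R : realType} {E : orderTopZmodType}.
Context (mu : {measure set (borelType E) -> \bar R}).
Implicit Types (b : bool) (r s t x : E).

(** The limits along this filter are the essential limits at [t], from the right
    for [b = true] and from the left for [b = false]. *)
Definition ess_side b t : set_system (borelType E) :=
  [set P | exists2 s, side_lt b t s &
    almost_everywhere mu [set x | side_itv b t s x -> P x]].

Let ae_mu : Filter (almost_everywhere mu) := ae_filter_ringOfSetsType mu.
Local Existing Instance ae_mu.

Hypothesis E_uncountable : ~ countable [set: E].
Hypothesis E_separable : separable_space E.
Hypothesis E_connected : connected [set: E].
Hypothesis mu_haar : is_haar mu.

Local Instance ess_side_filter b t : ProperFilter (ess_side b t).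
Proof.
split=> [[s ts]|].
  move=> [N [mN muN0 itvN]].
  have mitv : measurable (side_itv b t s : set (borelType E)).
    by apply: sub_sigma_algebra; exact: open_side_itv.
  have /eqP := haar_open_neq0 E_separable mu_haar
    (open_side_itv b t s) (side_lt_dense E_connected ts).
  apply; apply/eqP; rewrite eq_le measure_ge0 andbT -muN0 le_measure ?inE//.
  by apply: subset_trans itvN => x tx /(_ tx).
split=> [|P Q [s ts sP] [s' ts' sQ]|P Q PQ [s ts sP]].
- have [s ts] := side_lt_exists b t E_uncountable.
  by exists s => //; apply: filterE => x _.
- have [s'' ts'' itvs''] := side_itv_meet ts ts'; exists s'' => //.
  by apply: filterS2 sP sQ => x sP sQ /itvs''[/sP Px /sQ].
- by exists s => //; apply: filterS sP => x sP /sP; exact: PQ.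
Qed.

Lemma ae_ess_side b t : almost_everywhere mu `<=` ess_side b t.
Proof.
move=> P aeP; have [s ts] := side_lt_exists b t E_uncountable.
by exists s => //; apply: filterS aeP => x Px _.
Qed.

Lemma ess_side_itv b t s : side_lt b t s -> ess_side b t (side_itv b t s).
Proof. by move=> ts; exists s => //; apply: filterE => x tx. Qed.

(** An interval is a neighbourhood of each of its points [r], hence it is seen
    by the essential limits at [r] from both sides. *)
Lemma ess_side_near b t s b' r : side_itv b t s r ->
  ess_side b' r (side_itv b t s).
Proof.
move=> /andP[tr rs]; have [->|b'N] := eqVneq b' b.
  apply: filterS (ess_side_itv rs) => x /andP[rx xs].
  by apply/andP; split=> //; exact: side_lt_trans tr rx.
have {b'N}-> : b' = ~~ b by case: b' b b'N {tr rs} => [] [].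
have rt : side_lt (~~ b) r t by rewrite side_ltN.
apply: filterS (ess_side_itv rt) => x; rewrite /side_itv/= !side_ltN.
by move=> /andP[xr tx]; rewrite tx (side_lt_trans xr rs).
Qed.

(** Next to [t], on either side, the step function at [r] is constant: it is
    enough to stay before [r] if [r] is on that side of [t]. *)
Lemma step_ess_cvg r b t :
  ess_cvg (F := ess_side b t) (step_Linf mu r)
    (if (if b then ole r t else olt r t) then 1 else 0).
Proof.
apply: ess_cvg_pi; first exact: ae_ess_side.
apply: (@cvg_near_cst _ R[i]^o).
have [s ts ns] : exists2 s, side_lt b t s & side_lt b t r -> s = r.
  have [tr|_] := boolP (side_lt b t r); first by exists r.
  by have [s ts] := side_lt_exists b t E_uncountable; exists s.
apply: filterS (ess_side_itv ts) => x /andP[tx xs] /=; rewrite /step.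
congr (if _ then _ else _).
have ltF (z : E) : olt z z = false by exact: (side_ltxx true).
case: b ts ns tx xs => /= ts ns tx xs.
- have [tr|] := boolP (olt t r).
    move: (tr) xs; rewrite (ns tr) olt_nge => /negbTE -> xr.
    by apply/negbTE/negP => rx; have := ltF r; rewrite (olt_trans rx xr).
  rewrite olt_nge negbK => rt; rewrite rt olt_nge.
  by move: tx; rewrite olt_nge; apply: contra => xr; exact: ole_trans xr rt.
- have [rt|/negP rNt] := boolP (olt r t); first by rewrite -(ns rt).
  by apply/negbTE/negP => rx; apply: rNt; exact: olt_trans rx tx.
Qed.

Lemma step_range_cvg b t (x : Linf mu) : range (step_Linf mu) x ->
  exists c, ess_cvg (F := ess_side b t) x c.
Proof. by move=> [r _ <-]; eexists; exact: step_ess_cvg. Qed.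

(** The character [t+] for [b = true], and [t-] for [b = false]. *)
Definition one_sided_char b t : Kspace mu :=
  exist _ (ess_lim (F := ess_side b t) (G := range (step_Linf mu)))
    (mem_set (ess_lim_is_character (@ae_ess_side b t) (@step_range_cvg b t))).

Lemma one_sided_charP b t (y : Cstar_gen (range (step_Linf mu))) :
  ess_cvg (F := ess_side b t) (val y) (val (one_sided_char b t) y).
Proof. exact: (ess_limP (@ae_ess_side b t) (@step_range_cvg b t)). Qed.

Lemma one_sided_char_neq t : one_sided_char true t <> one_sided_char false t.
Proof.
have tA : step_Linf mu t \in gen_pred (range (step_Linf mu)).
  by apply/gen_predP => B [_]; apply; exists t.
pose y : Cstar_gen (range (step_Linf mu)) := Sub (step_Linf mu t) tA.
have chiE b : val (one_sided_char b t) y = if b then 1 else 0.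
  apply: ess_cvg_unique (@one_sided_charP b t y) _.
  have := @step_ess_cvg t b t.
  by rewrite ole_refl [olt t t](side_ltxx true); case: b.
move=> /(congr1 (fun p : Kspace mu => val p y)); rewrite !chiE.
by move=> /eqP; rewrite oner_eq0.
Qed.

(** The pairs [(b', r)] stand for the characters [r+] and [r-], where [r] tends
    to [t] from one side while [b'] is arbitrary. *)
Definition side_nbhs b t : set_system (bool * E) :=
  filter_from [set s | side_lt b t s] (fun s => [set br | side_itv b t s br.2]).

Local Instance side_nbhs_filter b t : Filter (side_nbhs b t).
Proof.
apply: filter_from_filter; first exact: side_lt_exists.
move=> s s' ts ts'; have [s'' ts'' itvs''] := side_itv_meet ts ts'.
by exists s'' => // -[b' r] /itvs''.
Qed.

(** If a function is almost everywhere within [e/2] of [c] on an interval, its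
    one-sided essential limits at the points of the interval are within [e] of
    [c]: compare the two at a generic point. *)
Lemma one_sided_char_cvg b t :
  one_sided_char br.1 br.2 @[br --> side_nbhs b t] --> one_sided_char b t.
Proof.
apply: character_space_cvg => y; apply/cvg_normcP => e e0.
have e20 : 0 < e / 2 by rewrite divr_gt0.
have /cvg_normcP/(_ _ e20)[s ts ys] := @one_sided_charP b t y.
exists s => // -[b' r] /= tr.
have /cvg_normcP/(_ _ e20) yr := @one_sided_charP b' r y.
have [x [[xr ys_x] xts]] := @filter_ex _ (ess_side b' r) _ _
  (filterI (filterI yr (@ae_ess_side b' r _ ys)) (ess_side_near b' tr)).
have tri (u v w : R[i]) :
    normc (w - u) < e / 2 -> normc (w - v) < e / 2 -> normc (u - v) < e.
  move=> wu wv; rewrite (_ : u - v = - (w - u) + (w - v)); last first.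
    by rewrite opprB addrA subrK.
  by rewrite (le_lt_trans (le_normcD _ _))// normcN [ltRHS]splitr ltrD.
exact: tri xr (ys_x xts).
Qed.

(** For an open [U], the points [t] with [t+] in [U] and [t-] outside [U] are
    isolated from the right, since [U] contains [r+] and [r-] for all [r]
    slightly larger than [t]; the points with [t-] in [U] and [t+] outside [U]
    are isolated from the left. *)
Lemma countable_separated (A : set (Kspace mu)) : Bor (Kspace mu) A ->
  countable [set t | A (one_sided_char true t) <> A (one_sided_char false t)].
Proof.
move: A; apply: smallest_sub; first exact: countable_separated_sigma_algebra.
move=> U openU.
have cU b : countable [set t | U (one_sided_char b t) /\
    ~ U (one_sided_char (~~ b) t)].
  apply: (@countable_side_isolated _ b) => // t [Ut _].
  have [s ts sU] : side_nbhs b t [set br | U (one_sided_char br.1 br.2)].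
    by apply: one_sided_char_cvg; exact: open_nbhs_nbhs.
  by exists s => // r tr [_]; apply; exact: (sU (~~ b, r)).
have := bigcup_countable (countableP [set: bool]) (fun b _ => cU b).
apply: sub_countable; apply: subset_card_le => t /= UN.
have [Ut|Ut] := pselect (U (one_sided_char true t)).
  by exists true => //; split => // Uf; apply: UN; exact/propext.
have [Uf|Uf] := pselect (U (one_sided_char false t)).
  by exists false.
by exfalso; apply: UN; exact/propext.
Qed.

(** A rectangle [A x B] can separate the two points only if [B] separates [t+]
    from [t-]. *)
Lemma countable_pair_separated (D : set (Kspace mu * Kspace mu)) :
  prod_sigma_algebra (Bor (Kspace mu)) (Bor (Kspace mu)) D ->
  countable [set t | D (one_sided_char true t, one_sided_char true t) <>
                     D (one_sided_char true t, one_sided_char false t)].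
Proof.
move: D; apply: smallest_sub.
  exact: (countable_separated_sigma_algebra (fun t => (_, _))).
move=> _ [A _ [B BorB <-]] /=.
apply: sub_countable (countable_separated BorB); apply: subset_card_le => t.
apply: contra_not => BE; apply/propext.
by split=> -[At Bt]; split=> //=; [rewrite -BE|rewrite BE].
Qed.

End one_sided_limits.

Theorem corollary19 (R : realType) (E : orderTopZmodType)
  (mu : {measure set (borelType E) -> \bar R})
  (E_uncountable : ~ countable [set: E])
  (E_locally_compact : locally_compact [set: E])
  (E_separable : separable_space E)
  (E_connected : connected [set: E])
  (mu_haar : is_haar mu) :
  prod_sigma_algebra (Bor (Kspace mu)) (Bor (Kspace mu))
    `<` Bor (Kspace mu * Kspace mu)%type.
Proof.
split; first exact: prod_sigma_algebra_Bor.
move=> Bor_sub.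
pose D : set (Kspace mu * Kspace mu) := [set pq | pq.1 <> pq.2].
have /Bor_sub : Bor (Kspace mu * Kspace mu)%type D.
  apply: (@sub_sigma_algebra _ setT open).
  exact: (@open_off_diagonal _ _ _ mu (range (step_Linf mu))).
move=> /(countable_pair_separated E_uncountable E_separable E_connected
  mu_haar) cD.
apply: (E_uncountable); apply: sub_countable cD.
apply: subset_card_le => t _ /=; rewrite /D/= => DE.
have neq := @one_sided_char_neq _ _ _ E_uncountable E_separable E_connected
  mu_haar t.
by have : _ <> _ := neq; rewrite -DE; apply.
Qed.
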